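(* Let $X$ be a uniformly convex Banach space and let $\{r_j\}_{j\ge1}$ be the sequence associated with $X$ by $r_1=1$ and, for every natural $j$, $r_{j+1}$ being the unique solution of $r_{j+1}\cdot\zeta^-_X(r_{j+1})=r_j$. Let $k\ge1$ be a natural number, $\alpha\in(0,1]$ and $\beta=1-(1-\alpha)^{1/k}$. Let $\mathcal{F}_1,\dots,\mathcal{F}_k$ be finite and non-empty families of convex sets in $X$. If for at least an $\alpha$ fraction of the rainbow $k$-tuples $K_1\in\mathcal{F}_1,\dots,K_k\in\mathcal{F}_k$ the set $\bigcap_{i=1}^kK_i$ contains a point of the unit ball $\mathbf{B}$, then there exist $x\in X$ and $i\in\{1,\dots,k\}$ such that at least $\beta|\mathcal{F}_i|$ elements of $\mathcal{F}_i$ intersect the ball $r_k\mathbf{B}+x$.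
   Context: Banach spaces are real, of dimension at least $2$. $\mathbf{B}=\{x\in X:\|x\|\le1\}$; $|\mathcal F|$ is the size of $\mathcal F$. A rainbow $k$-tuple is a choice of one set from each of $\mathcal{F}_1,\dots,\mathcal{F}_k$. The modulus of convexity is $\delta_X(\varepsilon)=\inf\{1-\frac{\|x+y\|}{2}: x,y\in\mathbf{B},\ \|x-y\|\ge\varepsilon\}$, $\varepsilon\in[0,2]$; $X$ is uniformly convex if $\delta_X>0$ on $(0,2]$. For $x\ne0$, $y$ is quasi-orthogonal to $x$, written $y\urcorner x$, if there is a non-zero continuous linear functional $p$ with $p(x)=\|p\|\|x\|$ and $p(y)=0$ (equivalently, $\|x+\lambda y\|\ge\|x\|$ for all $\lambda\in\mathbb{R}$). The function $\zeta^-_X:[0,\infty)\to[0,\infty)$ is $\zeta^-_X(\varepsilon)=\inf\{\|x+\varepsilon y\|:\|x\|=\|y\|=1,\ y\urcorner x\}$. The sequence $\{r_j\}$ is well-defined. *)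

(* Defs.v *)
From HB Require Import structures.
From mathcomp Require Export all_boot all_order all_algebra.
From mathcomp Require Export all_classical all_reals all_analysis.
Export Order.TTheory GRing.Theory Num.Theory.
Export numFieldNormedType.Exports.

Set Implicit Arguments.
Unset Strict Implicit.
Unset Printing Implicit Defensive.

Local Open Scope classical_set_scope.
Local Open Scope ring_scope.

Section NormedSpace.
Context {R : realType} (X : normedModType R).

Definition dim_ge2 : Prop :=
  exists u v : X, forall a b : R, a *: u + b *: v = 0 -> a = 0 /\ b = 0.

Definition unit_ball : set X := [set x | `|x| <= 1].

Definition scaled_ball (r : R) (x : X) : set X :=
  [set r *: b + x | b in unit_ball].

(* Used only for [0 <= e <= 2] and [dim_ge2]: the set is then non-empty and
   bounded below, so that [inf] is a genuine infimum. *)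
Definition modulus_convexity (e : R) : R :=
  inf [set d | exists x y : X, [/\ unit_ball x, unit_ball y, e <= `|x - y| &
                                   d = 1 - `|x + y| / 2]].

Definition uniformly_convex : Prop :=
  forall e : R, 0 < e <= 2 -> 0 < modulus_convexity e.

(* Dual norm; a genuine supremum as soon as [p] is linear and continuous. *)
Definition functional_norm (p : X -> R) : R :=
  sup [set `|p z| | z in unit_ball].

(* [quasi_orthogonal y x]: y is quasi-orthogonal to x (meant for [x != 0]). *)
Definition quasi_orthogonal (y x : X) : Prop :=
  exists p : {linear X -> R^o},
    [/\ continuous (p : X -> R^o), exists z, p z != 0,
        p x = functional_norm p * `|x| & p y = 0].

(* Used only for [0 <= e]. *)
Definition zeta_minus (e : R) : R :=
  inf [set `|xy.1 + e *: xy.2| | xy in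
        [set xy : X * X | [/\ `|xy.1| = 1, `|xy.2| = 1 &
                              quasi_orthogonal xy.2 xy.1]]].

(* [rseq j] is r_j for [1 <= j], and [rseq 0] is a dummy value.  [get] picks
   the solution in [0, +oo), the domain of [zeta_minus]. *)
Fixpoint rseq (j : nat) : R :=
  match j with
  | 0 | 1 => 1
  | j'.+1 => get [set t : R | 0 <= t /\ t * zeta_minus t = rseq j']
  end.

End NormedSpace.

Arguments unit_ball {R X}.

(* Main.v *)
From HB Require Import structures.
Require Import Defs.
From mathcomp Require Import ring lra.

(** Suppose that every ball of radius r = r_k misses more than a fraction
    g = 1 - beta of each family.  Since g ^ k = 1 - alpha, it is enough to
    show that the rainbow tuples whose intersection has no point in the unit
    ball make up more than a fraction g ^ k of all rainbow tuples.

    These tuples come from a greedy choice.  Given K_1, ..., K_j, let q_j be a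
    point of minimal norm in their intersection (q_0 = 0), and let K_(j+1) be
    any member of its family that misses the ball of radius r around q_j.  A
    fraction greater than g of the members is eligible at every step, and q_j
    does not depend on the member chosen at that step; resampling one coordinate
    at a time turns this into the count g ^ k ([evading_card]).

    For such a tuple |q_j| > r_k / r_j holds for every j >= 1
    ([nearest_growth]), so that |q_k| > 1 and the intersection avoids the unit
    ball.  Indeed |q_1| > r, and q_(j+1) lies in the convex set in which q_j has
    minimal norm, at distance greater than r from q_j.  In a Hilbert space
    Pythagoras would bound |q_(j+1)| from below.  Here the same role is played
    by the inequality |x| * zeta t <= |x + y|, valid when t * |x| <= |y| and x
    has minimal norm on the ray from x in direction y ([norm_zeta_minus_le]):
    if |q_(j+1)| were at most r_k / r_(j+1), it could be applied with
    t = r_(j+1), and r_(j+1) * zeta r_(j+1) = r_j gives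
    |q_(j+1)| > r_k / r_j * zeta r_(j+1) = r_k / r_(j+1) after all.

    The inequality with zeta is proved in the plane of x and y.  A functional
    norming x and nonnegative at y exists by the Hahn-Banach theorem; turning y,
    at constant norm, away from x until it reaches the kernel of that functional
    does not increase |x + y| ([rotate_away]), and a vector of the kernel is
    quasi-orthogonal to x.

    Points of minimal norm exist because each set may be replaced by the convex
    hull of finitely many of its points: one common point in the unit ball for
    each rainbow tuple that has one ([compact_convex_between]). *)

Set Implicit Arguments.
Unset Strict Implicit.
Unset Printing Implicit Defensive.
Local Open Scope classical_set_scope.
Local Open Scope ring_scope.

(** * Sublinear functionals and the Hahn-Banach theorem *)

Section HahnBanach.
Context {R : realType} {X : lmodType R}.
Implicit Types (p : X -> R) (u v y : X) (c m t : R).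

Definition sublinear p : Prop :=
  (forall u v, p (u + v) <= p u + p v) /\
  (forall t u, 0 <= t -> p (t *: u) <= t * p u).

Lemma sublinear0 p : sublinear p -> p 0 = 0.
Proof.
move=> [pD pZ]; apply/eqP; rewrite eq_le; apply/andP; split.
  by have := pZ 0 0 (lexx _); rewrite scale0r mul0r.
by have := pD 0 0; rewrite addr0; lra.
Qed.

Lemma sublinearZ p t u : sublinear p -> 0 <= t -> p (t *: u) = t * p u.
Proof.
move=> sp; rewrite le_eqVlt => /predU1P[<-|t0].
  by rewrite scale0r mul0r sublinear0.
apply/eqP; rewrite eq_le (sp.2 _ _ (ltW t0))/= -ler_pdivlMl//.
have := sp.2 t^-1 (t *: u); rewrite scalerA mulVf ?gt_eqF// scale1r.
by apply; rewrite invr_ge0 ltW.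
Qed.

Lemma sublinear_opp_le p u : sublinear p -> - p (- u) <= p u.
Proof.
by move=> sp; have := sp.1 u (- u); rewrite subrr sublinear0//; lra.
Qed.

(** The largest sublinear functional below [p] whose value at [- y] is at most
    [- c]; it exists as soon as [c <= p y].  A linear functional below it is
    below [p] and at least [c] at [y], so tilting imposes lower bounds on the
    functional that the Hahn-Banach theorem will produce. *)
Definition tilt p y c v : R :=
  inf [set p (v + t *: y) - t * c | t in [set t | 0 <= t]].

Lemma tilt_lbound p y c v : sublinear p -> c <= p y ->
  lbound [set p (v + t *: y) - t * c | t in [set t | 0 <= t]] (- p (- v)).
Proof.
move=> sp cy _ [t /= t0 <-].
have := sp.1 (v + t *: y) (- v); rewrite addrAC subrr add0r sublinearZ//.
by have := ler_wpM2l t0 cy; lra.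
Qed.

Lemma tilt_le p y c v t : sublinear p -> c <= p y -> 0 <= t ->
  tilt p y c v <= p (v + t *: y) - t * c.
Proof.
move=> sp cy t0; apply: ge_inf; last by exists t.
by exists (- p (- v)); exact: tilt_lbound.
Qed.

Lemma le_tilt p y c v m :
  (forall t, 0 <= t -> m <= p (v + t *: y) - t * c) -> m <= tilt p y c v.
Proof.
move=> H; apply: lb_le_inf; first by exists (p (v + 0 *: y) - 0 * c), 0 => /=.
by move=> _ [t /= t0 <-]; exact: H.
Qed.

Lemma tilt_le_self p y c v : sublinear p -> c <= p y -> tilt p y c v <= p v.
Proof.
move=> sp cy; have := tilt_le v sp cy (lexx 0).
by rewrite scale0r mul0r addr0 subr0.
Qed.

Lemma tilt_opp p y c : sublinear p -> c <= p y -> tilt p y c (- y) <= - c.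
Proof.
move=> sp cy; have := tilt_le (- y) sp cy ler01.
by rewrite scale1r addNr sublinear0// mul1r sub0r.
Qed.

Lemma tilt_sublinear p y c : sublinear p -> c <= p y -> sublinear (tilt p y c).
Proof.
move=> sp cy; split=> [u v|s u].
  rewrite -lerBlDr; apply: le_tilt => t t0.
  rewrite lerBlDr -lerBlDl; apply: le_tilt => t' t'0.
  rewrite lerBlDl; have := tilt_le (u + v) sp cy (addr_ge0 t0 t'0).
  have := sp.1 (u + t *: y) (v + t' *: y).
  by rewrite addrACA -scalerDl; lra.
rewrite le_eqVlt => /predU1P[<-|s0].
  rewrite scale0r mul0r; have := tilt_le_self 0 sp cy.
  by rewrite (sublinear0 sp).
rewrite -ler_pdivrMl//; apply: le_tilt => t t0.
rewrite ler_pdivrMl//.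
have /(tilt_le (s *: u) sp cy) : 0 <= s * t by rewrite mulr_ge0// ltW.
by rewrite -scalerA -scalerDr (sublinearZ _ sp (ltW s0)) mulrBr mulrA.
Qed.

(** Zorn's lemma applies because the pointwise infimum of a chain of sublinear
    functionals below [p] is sublinear: two members of the chain are comparable,
    so the smaller one witnesses subadditivity for both, and each is bounded
    below at [v] by [- p (- v)]. *)
Lemma sublinear_minimal p : sublinear p ->
  exists q, [/\ sublinear q, forall v, q v <= p v &
    forall q', sublinear q' -> (forall v, q' v <= q v) -> q' = q].
Proof.
move=> sp.
pose T := {q : X -> R | sublinear q /\ forall v, q v <= p v}.
pose below (q q' : T) : bool := `[< forall v, sval q' v <= sval q v >].
have [||||[q [sq qp]] qmin] := @Zorn T below.
- by move=> q; apply/asboolP.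
- move=> q1 q2 q3 /asboolP q12 /asboolP q23; apply/asboolP => v.
  exact: le_trans (q23 v) (q12 v).
- move=> [q1 h1] [q2 h2] /asboolP/= q12 /asboolP/= q21; apply: eq_exist.
  by apply/funext => v; apply/eqP; rewrite eq_le q12 q21.
- move=> A Atot.
  have [[q0 Aq0]|A0] := pselect (A !=set0); last first.
    exists (exist _ p (conj sp (fun v => lexx _))) => q Aq.
    by exfalso; apply: A0; exists q.
  pose S v := [set sval q v | q in A].
  have lbS v : lbound (S v) (- p (- v)).
    move=> _ [[q [sq qp]] Aq <-] /=.
    by apply: le_trans (sublinear_opp_le _ sq); rewrite lerN2.
  have infS v q : A q -> inf (S v) <= sval q v.
    by move=> Aq; apply: ge_inf; [exists (- p (- v))|exists q].
  have leS v m : (forall q, A q -> m <= sval q v) -> m <= inf (S v).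
    move=> H; apply: lb_le_inf; first by exists (sval q0 v), q0.
    by move=> _ [q Aq <-]; exact: H.
  have infp : sublinear (fun v => inf (S v)) /\ forall v, inf (S v) <= p v.
    split; last first.
      by move=> v; apply: le_trans (infS v _ Aq0) _; exact: (svalP q0).2.
    split=> [u v|t u t0].
      rewrite -lerBlDr; apply/leS => q1 Aq1.
      rewrite lerBlDr -lerBlDl; apply/leS => q2 Aq2; rewrite lerBlDl.
      have [/asboolP q12|/asboolP q21] := Atot _ _ Aq1 Aq2.
        apply: le_trans (infS (u + v) _ Aq2) _.
        by apply: le_trans ((svalP q2).1.1 u v) _; rewrite lerD2r.
      apply: le_trans (infS (u + v) _ Aq1) _.
      by apply: le_trans ((svalP q1).1.1 u v) _; rewrite lerD2l.
    move: t0; rewrite le_eqVlt => /predU1P[<-|t0].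
      rewrite scale0r mul0r; apply: le_trans (infS 0 _ Aq0) _.
      by rewrite (sublinear0 (svalP q0).1).
    rewrite -ler_pdivrMl//; apply/leS => q Aq; rewrite ler_pdivrMl//.
    apply: le_trans (infS _ _ Aq) _.
    by apply: (svalP q).1.2; exact: ltW.
  exists (exist _ (fun v => inf (S v)) infp : T) => q Aq.
  by apply/asboolP => v /=; exact: infS.
exists q; split=> // q' sq' q'q.
have q'p : sublinear q' /\ forall v, q' v <= p v.
  by split=> // v; apply: le_trans (qp v).
have qq' : below (exist _ q (conj sq qp)) (exist _ q' q'p) by exact/asboolP.
by have /(congr1 sval) := qmin _ qq'.
Qed.

(** A minimal sublinear functional [q] is linear: tilting it along [v] with
    [c = q v] gives a smaller sublinear functional, hence [q] itself, and so
    [q (- v) <= - q v]; an odd sublinear functional is additive. *)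
Theorem hahn_banach p : sublinear p ->
  exists f : {linear X -> R^o}, forall v, f v <= p v.
Proof.
move=> sp; have [q [sq qp qmin]] := sublinear_minimal sp.
have qN v : q (- v) = - q v.
  apply/eqP; rewrite eq_le; apply/andP; split; last first.
    by have := sublinear_opp_le v sq; lra.
  have := tilt_opp sq (lexx (q v)).
  rewrite (qmin (tilt q v (q v)))//; first exact: tilt_sublinear.
  by move=> w; exact: tilt_le_self.
have qD u v : q (u + v) = q u + q v.
  apply/eqP; rewrite eq_le sq.1/=.
  by have := sq.1 (- u) (- v); rewrite -opprD !qN; lra.
have qZ t v : q (t *: v) = t * q v.
  have [t0|/ltW t0] := leP 0 t; first exact: sublinearZ.
  rewrite -[t]opprK scaleNr qN sublinearZ ?oppr_ge0//; ring.
have qlin : linear (q : X -> R^o) by move=> t u v; rewrite qD qZ.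
pose L := GRing.isLinear.Build R X R^o _ q qlin.
pose f : {linear X -> R^o} := HB.pack (q : X -> R^o) L.
by exists f.
Qed.

End HahnBanach.

(** * Supporting functionals and quasi-orthogonality *)

Section Norming.
Context {R : realType} {X : normedModType R}.
Implicit Types (f : {linear X -> R^o}) (x y v w : X).

Definition norming f x : Prop := (forall v, `|f v| <= `|v|) /\ f x = `|x|.

Lemma sublinear_norm : sublinear (fun v : X => `|v|).
Proof.
by split=> [u v|t u t0]; [exact: ler_normD|rewrite normrZ ger0_norm].
Qed.

(** The norm is tilted twice, to force [`|x| <= f x] and then [0 <= f y].  The
    second tilt is possible exactly because [x] has minimal norm on the ray. *)
Lemma norming_functional x y :
  (forall t : R, 0 <= t -> `|x| <= `|x + t *: y|) ->
  exists f, norming f x /\ 0 <= f y.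
Proof.
move=> xy; have sN := sublinear_norm.
pose q := tilt (fun v : X => `|v|) x `|x|.
have sq : sublinear q by exact: tilt_sublinear.
have q0 : 0 <= q y.
  apply: le_tilt => t; rewrite le_eqVlt subr_ge0 => /predU1P[<-|t0].
    by rewrite mul0r.
  rewrite -[y](scalerKV (lt0r_neq0 t0)) -scalerDr normrZ gtr0_norm// addrC.
  by rewrite ler_pM2l// xy// invr_ge0 ltW.
have [f fp] := hahn_banach (tilt_sublinear sq q0).
have fq v : f v <= q v := le_trans (fp v) (tilt_le_self v sq q0).
have fN v : f v <= `|v| := le_trans (fq v) (tilt_le_self v sN (lexx _)).
exists f; split; last first.
  have := le_trans (fp (- y)) (tilt_opp sq q0).
  by rewrite linearN oppr0 oppr_le0.
split=> [v|].
  by rewrite ler_norml fN lerNl -linearN -[leRHS]normrN fN.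
apply/eqP; rewrite eq_le fN/=.
have := le_trans (fq (- x)) (tilt_opp sN (lexx _)).
by rewrite linearN lerN2.
Qed.

Lemma norming_orthogonal f x w (t : R) : norming f x -> f w = 0 ->
  `|x| <= `|x + t *: w|.
Proof.
move=> [fN fx] fw; rewrite -fx; apply: le_trans (fN _).
by rewrite linearD linearZ/= fw scaler0 addr0 ler_norm.
Qed.

Lemma norming_quasi_orthogonal f x w : x != 0 -> norming f x -> f w = 0 ->
  quasi_orthogonal w x.
Proof.
move=> x0 [fN fx] fw; exists f; split=> //.
- apply: bounded_linear_continuous; apply/linear_boundedP.
  near=> r => v; apply: le_trans (fN v) _.
  by rewrite ler_peMl.
- by exists x; rewrite fx normr_eq0.
rewrite fx /functional_norm.
have nx : 0 < `|x| by rewrite normr_gt0.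
suff -> : sup [set `|f z| | z in unit_ball] = 1 by rewrite mul1r.
apply/eqP; rewrite eq_le; apply/andP; split.
  apply: ge_sup; first by exists `|f 0|, 0 => //; rewrite /unit_ball/= normr0.
  by move=> _ [z /= z1 <-]; exact: le_trans (fN z) z1.
apply: ub_le_sup.
  by exists 1 => _ [z /= z1 <-]; exact: le_trans (fN z) z1.
exists (`|x|^-1 *: x).
  by rewrite /unit_ball/= normrZ normfV normr_id mulVf ?gt_eqF.
by rewrite linearZ/= fx normrZ normfV normr_id mulVf ?gt_eqF// normr1.
Unshelve. all: by end_near. Qed.

Lemma quasi_orthogonal_norm_ge x y (t : R) : quasi_orthogonal y x ->
  `|x| <= `|x + t *: y|.
Proof.
move=> [p [cp [z pz0] px py]].
have /linear_boundedP := @continuous_linear_bounded R X R^o 0 p (cp 0).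
move=> /pinfty_ex_gt0[M M0 pM].
have ubp : has_ubound [set `|p z| | z in unit_ball].
  exists M => _ [v /= v1 <-]; apply: le_trans (pM v) _.
  by rewrite ler_piMr// ltW.
have pN v : `|p v| <= functional_norm p * `|v|.
  have [->|v0] := eqVneq v 0; first by rewrite linear0 !normr0 mulr0.
  have nv : 0 < `|v| by rewrite normr_gt0.
  rewrite -ler_pdivrMr//; apply: ub_le_sup => //.
  exists (`|v|^-1 *: v).
    by rewrite /unit_ball/= normrZ normfV normr_id mulVf ?gt_eqF.
  by rewrite linearZ/= normrZ normfV normr_id mulrC.
have N0 : 0 < functional_norm p.
  rewrite -(@pmulr_lgt0 _ `|z|); last first.
    by rewrite normr_gt0; apply: contra_neq pz0 => ->; rewrite linear0.
  by apply: lt_le_trans (pN z); rewrite normr_gt0.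
rewrite -(ler_pM2l N0) -px; apply: le_trans (pN _).
by rewrite linearD linearZ/= py scaler0 addr0 ler_norm.
Qed.

Lemma ker_neq0 f : dim_ge2 X -> exists2 e, e != 0 & f e = 0.
Proof.
move=> [u [v uv]].
have [fu0|fu0] := eqVneq (f u) 0.
  exists u => //; apply/eqP => u0; have := uv 1 0.
  by rewrite u0 scaler0 scale0r addr0 => /(_ erefl)[] /eqP; rewrite oner_eq0.
exists (f v *: u + (- f u) *: v).
  apply/eqP => /uv[_ /eqP]; rewrite oppr_eq0; exact/negP.
rewrite linearD !linearZ/= /GRing.scale/= mulNr; apply/eqP.
by rewrite subr_eq0 mulrC.
Qed.

End Norming.

(** * The modulus zeta and the radii r_j *)

Section Zeta.
Context {R : realType} {X : normedModType R} (dimX : dim_ge2 X).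
Implicit Types (x y : X) (e : R).
Local Notation zeta := (zeta_minus X).

Lemma exists_unit_orthogonal x : x != 0 ->
  exists y, `|y| = 1 /\ quasi_orthogonal y x.
Proof.
move=> x0.
have [f [fx _]] : exists f : {linear X -> R^o}, norming f x /\ 0 <= f 0.
  by apply: norming_functional => t _; rewrite scaler0 addr0.
have [e e0 fe] := ker_neq0 f dimX; exists (`|e|^-1 *: e); split.
  by rewrite normrZ normfV normr_id mulVf// normr_eq0.
by apply: norming_quasi_orthogonal fx _ => //; rewrite linearZ/= fe scaler0.
Qed.

Lemma zeta_minus_le e x y : `|x| = 1 -> `|y| = 1 -> quasi_orthogonal y x ->
  zeta e <= `|x + e *: y|.
Proof.
move=> x1 y1 yx; apply: ge_inf; last by exists (x, y).
by exists 0 => _ [? _ <-].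
Qed.

Lemma le_zeta_minus e m :
  (forall x y, `|x| = 1 -> `|y| = 1 -> quasi_orthogonal y x ->
     m <= `|x + e *: y|) -> m <= zeta e.
Proof.
move=> H; apply: lb_le_inf; last by move=> _ [[x y] /= [x1 y1 yx] <-]; exact: H.
have [u [v uv]] := dimX.
have u0 : u != 0.
  apply/eqP => u0; have := uv 1 0.
  by rewrite u0 scaler0 scale0r addr0 => /(_ erefl)[] /eqP; rewrite oner_eq0.
pose x := `|u|^-1 *: u.
have x1 : `|x| = 1 by rewrite normrZ normfV normr_id mulVf// normr_eq0.
have [|y [y1 yx]] := @exists_unit_orthogonal x.
  by rewrite -normr_eq0 x1 oner_eq0.
by exists `|x + e *: y|, (x, y).
Qed.

Lemma zeta_minus_ge1 e : 1 <= zeta e.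
Proof.
by apply: le_zeta_minus => x y <- _; exact: quasi_orthogonal_norm_ge.
Qed.

(** [zeta] is an infimum of functions of [e] that are 1-Lipschitz. *)
Lemma zeta_minus_lipschitz e e' : zeta e <= zeta e' + `|e - e'|.
Proof.
rewrite -lerBlDr; apply: le_zeta_minus => x y x1 y1 yx; rewrite lerBlDr.
apply: le_trans (zeta_minus_le e x1 y1 yx) _.
have -> : x + e *: y = (x + e' *: y) + (e - e') *: y.
  by rewrite -addrA -scalerDl addrC subrKC addrC.
by rewrite (le_trans (ler_normD _ _))// normrZ y1 mulr1.
Qed.

Lemma zeta_minus_continuous : continuous (zeta : R -> R).
Proof.
move=> e; apply/cvgrPdist_le => d d0; near=> e'.
have : `|e - e'| <= d by near: e'; exact: cvgr_dist_le.
have := zeta_minus_lipschitz e e'; have := zeta_minus_lipschitz e' e.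
by rewrite [`|e' - e|]distrC => h1 h2 h3; rewrite ler_norml; lra.
Unshelve. all: by end_near. Qed.

End Zeta.

Section Rseq.
Context {R : realType} {X : normedModType R} (dimX : dim_ge2 X).
Local Notation zeta := (zeta_minus X).

(** Intermediate value theorem on [[0, 1]], where [t * zeta t] goes from [0] to
    [zeta 1 >= 1]. *)
Lemma zeta_minus_equation (r : R) : 0 <= r <= 1 ->
  exists t : R, 0 <= t /\ t * zeta t = r.
Proof.
move=> /andP[r0 r1].
have [||t] := @IVT R (fun t => t * zeta t) 0 1 r ler01.
- apply: continuous_subspaceT => t.
  by apply: cvgM; [exact: cvg_id|exact: zeta_minus_continuous].
- have z1 := zeta_minus_ge1 dimX 1.
  by rewrite mul0r mul1r ge_min r0 le_max (le_trans r1 z1) orbT.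
by rewrite in_itv/= => /andP[t0 _] tr; exists t.
Qed.

Lemma rseqS_sol j : 0 <= rseq X j.+1 <= 1 ->
  0 <= rseq X j.+2 /\ rseq X j.+2 * zeta (rseq X j.+2) = rseq X j.+1.
Proof.
move=> /zeta_minus_equation solvable.
exact: (@getPex _ [set t : R | 0 <= t /\ t * zeta t = rseq X j.+1]).
Qed.

Lemma rseq_bound j : 0 < rseq X j.+1 <= 1.
Proof.
elim: j => [|j /andP[j0 j1]]; first by rewrite ltr01 lexx.
have [|r0 rE] := @rseqS_sol j; first by rewrite ltW.
have z1 := zeta_minus_ge1 dimX (rseq X j.+2).
move: r0; rewrite le_eqVlt => /predU1P[r0|r0].
  by move: rE j0; rewrite -r0 mul0r => <-; rewrite ltxx.
by rewrite r0/= (le_trans _ j1)// -rE ler_peMr// ltW.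
Qed.

Lemma rseq_gt0 j : 0 < rseq X j.+1.
Proof. by have /andP[] := rseq_bound j. Qed.

Lemma rseq_eq j : rseq X j.+2 * zeta (rseq X j.+2) = rseq X j.+1.
Proof.
have /andP[/ltW j0 j1] := rseq_bound j.
by have [|] := @rseqS_sol j; first by rewrite j0.
Qed.

End Rseq.

(** * Norm growth away from a point of minimal norm *)

Section Geometry.
Context {R : realType} {X : normedModType R}.
Implicit Types (f : {linear X -> R^o}) (x y z v w e : X) (a b t : R).

Lemma norming_orthogonal_homo f x w t : norming f x -> f w = 0 ->
  0 <= t <= 1 -> `|x + t *: w| <= `|x + w|.
Proof.
move=> fx fw /andP[t0 t1].
have -> : x + t *: w = (1 - t) *: x + t *: (x + w).
  by rewrite scalerBl scale1r scalerDr addrA subrK.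
rewrite (le_trans (ler_normD _ _))// !normrZ !ger0_norm ?subr_ge0//.
have := norming_orthogonal 1 fx fw; rewrite scale1r => xw.
have : (1 - t) * `|x| <= (1 - t) * `|x + w| by rewrite ler_wpM2l ?subr_ge0.
lra.
Qed.

(** Monotonicity of the distance in a normed plane.  With [y = a *: x + b *: e],
    the segment from [- x] to [y] meets the ray spanned by [e] at [l *: e],
    where [b = (1 + a) * l], and [x + y = (1 + a) *: (x + l *: e)].
    If [1 <= l] then [`|x + e| <= `|x + l *: e|] by quasi-orthogonality.
    If [l < 1] then [l *: e] lies on both segments [[- x, y]] and [[0, e]], and
    the triangle inequality for their end points, together with
    [`|y| = `|e|], concludes. *)
Lemma rotate_away f x e a b : norming f x -> f e = 0 -> 0 <= a -> 0 <= b ->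
  `|a *: x + b *: e| = `|e| -> `|x + e| <= `|x + (a *: x + b *: e)|.
Proof.
move=> fx fe a0 b0 ye; have a1 : 0 < 1 + a by lra.
have [l bE l0] : exists2 l, b = (1 + a) * l & 0 <= l.
  exists (b / (1 + a)); last by rewrite divr_ge0// ltW.
  by rewrite mulrC divfK// gt_eqF.
have -> : x + (a *: x + b *: e) = (1 + a) *: (x + l *: e).
  by rewrite scalerDr scalerA -bE scalerDl scale1r addrA.
rewrite normrZ gtr0_norm//.
have [l1|l1] := leP 1 l.
  have l_gt0 : 0 < l by exact: lt_le_trans l1.
  have : `|x + e| <= `|x + l *: e|.
    have := @norming_orthogonal_homo f x (l *: e) l^-1 fx.
    rewrite linearZ/= fe scaler0 scalerA mulVf ?gt_eqF// scale1r; apply => //.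
    by rewrite invr_ge0 l0 invf_le1.
  by move/le_trans; apply; rewrite ler_peMl//; lra.
have yl : `|e| <= l * `|e| + a * `|x + l *: e|.
  rewrite -[in leLHS]ye.
  have -> : a *: x + b *: e = l *: e + a *: (x + l *: e).
    rewrite scalerDr addrCA; congr (_ + _).
    by rewrite scalerA -scalerDl bE; congr (_ *: _); ring.
  by rewrite (le_trans (ler_normD _ _))// !normrZ !ger0_norm.
have : `|x + e| <= `|x + l *: e| + (1 - l) * `|e|.
  have -> : x + e = (x + l *: e) + (1 - l) *: e.
    by rewrite -addrA -scalerDl subrKC scale1r.
  rewrite (le_trans (ler_normD _ _))// normrZ.
  by rewrite [ `|1 - l|]ger0_norm// subr_ge0 ltW.
by lra.
Qed.

(** A convex function of [t] that is at least its value at 0 on [[0, 1]] stays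
    so beyond. *)
Lemma norm_min_ray (x y : X) :
  (forall t : R, 0 <= t <= 1 -> `|x| <= `|x + t *: y|) ->
  forall t : R, 0 <= t -> `|x| <= `|x + t *: y|.
Proof.
move=> xy t t0; have [t1|/ltW t1] := leP t 1; first by apply: xy; rewrite t0.
have t_gt0 : 0 < t by exact: lt_le_trans t1.
have tV0 : 0 < t^-1 by rewrite invr_gt0.
have tV1 : t^-1 <= 1 by rewrite invf_le1.
have := xy 1; rewrite ler01 lexx scale1r => /(_ isT).
have -> : x + y = (1 - t^-1) *: x + t^-1 *: (x + t *: y).
  rewrite scalerDr scalerA mulVf ?gt_eqF// scale1r addrA.
  by rewrite -scalerDl subrK scale1r.
move=> /le_trans/(_ (ler_normD _ _)).
rewrite !normrZ !ger0_norm ?subr_ge0 ?(ltW tV0)// => h.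
by rewrite -(ler_pM2l tV0); lra.
Qed.

(** The substitute for the Pythagorean theorem.  The vector [y] is first turned
    into a vector [e] of the same norm that is quasi-orthogonal to [x], which
    does not increase [`|x + y|]; then [`|x + e|] is estimated by [zeta]. *)
Lemma norm_zeta_minus_le x y (t : R) : dim_ge2 X -> x != 0 -> 0 < t ->
  (forall s : R, 0 <= s -> `|x| <= `|x + s *: y|) ->
  t * `|x| <= `|y| -> `|x| * zeta_minus X t <= `|x + y|.
Proof.
move=> dimX x0 t0 xy ty.
have nx : 0 < `|x| by rewrite normr_gt0.
have ny : 0 < `|y| by apply: lt_le_trans ty; rewrite mulr_gt0.
have [f [fx fy]] := norming_functional xy.
have [e [fe eE ey]] : exists e,
    [/\ f e = 0, `|e| = `|y| & `|x + e| <= `|x + y|].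
  pose a := f y / `|x|; pose w := y - a *: x.
  have a0 : 0 <= a by rewrite divr_ge0.
  have fw : f w = 0.
    by rewrite linearB linearZ/= fx.2 /GRing.scale/= divfK ?subrr// gt_eqF.
  have yE : y = a *: x + w by rewrite addrC subrK.
  (* If y is a multiple of x, any vector of the kernel will do: then
     |x + y| = |x| + |y|. *)
  have [w0|w0] := eqVneq w 0.
    have [e e0 fe] := ker_neq0 f dimX.
    have ne : `|e| != 0 by rewrite normr_eq0.
    exists ((`|y| / `|e|) *: e); rewrite linearZ/= fe scaler0.
    have E : `|(`|y| / `|e|) *: e| = `|y|.
      by rewrite normrZ normrM normfV !normr_id divfK.
    split=> //; rewrite (le_trans (ler_normD _ _))// E yE w0 addr0.
    rewrite -{3}[x]scale1r -scalerDl !normrZ !ger0_norm ?addr_ge0//.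
    by rewrite mulrDl mul1r.
  have nw : 0 < `|w| by rewrite normr_gt0.
  pose e := (`|y| / `|w|) *: w.
  have eE : `|e| = `|y|.
    by rewrite normrZ normrM normfV !normr_id divfK// gt_eqF.
  have fe : f e = 0 by rewrite linearZ/= fw scaler0.
  have ye : y = a *: x + (`|w| / `|y|) *: e.
    by rewrite scalerA mulrA divfK ?gt_eqF// divff ?gt_eqF// scale1r.
  exists e; split=> //; rewrite [X in _ <= `|x + X|]ye.
  by apply: (rotate_away fx) => //; rewrite -ye eE.
apply: le_trans ey.
have ne : 0 < `|e| by rewrite eE.
(* Normalization to unit vectors; t is then increased to |e| / |x|, which is
   harmless along a quasi-orthogonal direction. *)
pose u := `|x|^-1 *: x; pose d := `|e|^-1 *: e.
have xu : x = `|x| *: u by rewrite scalerA divff ?gt_eqF// scale1r.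
have ed : e = `|e| *: d by rewrite scalerA divff ?gt_eqF// scale1r.
have fd : f d = 0 by rewrite linearZ/= fe scaler0.
have fu : norming f u.
  split=> [v|]; first exact: fx.1.
  by rewrite linearZ/= fx.2 normrZ normfV normr_id.
have u1 : `|u| = 1 by rewrite normrZ normfV normr_id mulVf// gt_eqF.
have d1 : `|d| = 1 by rewrite normrZ normfV normr_id mulVf// gt_eqF.
have -> : x + e = `|x| *: (u + (`|e| / `|x|) *: d).
  by rewrite scalerDr -xu scalerA mulrC divfK ?gt_eqF// -ed.
rewrite normrZ normr_id ler_pM2l//.
have ud : quasi_orthogonal d u.
  by apply: norming_quasi_orthogonal fu fd; rewrite -normr_eq0 u1 oner_eq0.
apply: le_trans (zeta_minus_le t u1 d1 ud) _.
have ex : 0 < `|e| / `|x| by rewrite divr_gt0.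
have := @norming_orthogonal_homo f u ((`|e| / `|x|) *: d)
  (t / (`|e| / `|x|)) fu.
rewrite [X in _ + X]scalerA (divfK (lt0r_neq0 ex)).
apply; first by rewrite linearZ/= fd scaler0.
apply/andP; split; first by rewrite divr_ge0 // ltW.
by rewrite ler_pdivrMr// mul1r ler_pdivlMr// eE.
Qed.

End Geometry.

(** * Compact convex sets *)

Section Hull.
Context {R : realType} {X : normedModType R}.
Implicit Types (A : set X) (x y p : X) (t : R).

Lemma convex_setP A : convex_set (A : set (convex_lmodType X)) <->
  (forall x y t, 0 <= t <= 1 -> A x -> A y -> A (t *: x + (1 - t) *: y)).
Proof.
split=> [cA x y t /andP[t0 t1] Ax Ay|cA x y l]; last first.
  by rewrite !inE => Ax Ay; apply: cA => //; apply/andP; split.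
by have := cA x y (Itv01 t0 t1); rewrite !inE; exact.
Qed.

Definition cone_over p A : set X :=
  [set t *: p + (1 - t) *: y | t in `[0, 1] & y in A].

Lemma compact_cone_over p A : compact A -> compact (cone_over p A).
Proof.
move=> cA; pose g (ty : R * X) := ty.1 *: p + (1 - ty.1) *: ty.2.
have -> : cone_over p A = g @` (`[0, 1] `*` A).
  apply/seteqP; split=> [_ [t t01 [y Ay <-]]|_ [[t y] [/= t01 Ay] <-]].
    by exists (t, y).
  by exists t => //; exists y.
apply: continuous_compact; last first.
  by apply: compact_setX => //; exact: segment_compact.
apply: continuous_subspaceT => ty; apply: cvgD.
  by apply: cvgZ; [exact: cvg_fst|exact: cvg_cst].
apply: cvgZ; last exact: cvg_snd.
by apply: cvgB; [exact: cvg_cst|exact: cvg_fst].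
Qed.

Lemma convex_cone_over p A : convex_set (A : set (convex_lmodType X)) ->
  convex_set (cone_over p A : set (convex_lmodType X)).
Proof.
move=> /convex_setP cA; apply/convex_setP => p1 p2 l /andP[l0 l1].
move=> [s + [x Ax <-]] [t + [y Ay <-]]; rewrite /= !in_itv/=.
move=> /andP[s0 s1] /andP[t0 t1].
have l1' : 0 <= 1 - l by lra.
pose m := l * (1 - s) + (1 - l) * (1 - t).
have ls0 : 0 <= l * (1 - s) by rewrite mulr_ge0// subr_ge0.
have lt0 : 0 <= (1 - l) * (1 - t) by rewrite mulr_ge0// subr_ge0.
have ls0' : 0 <= l * s by rewrite mulr_ge0.
have lt0' : 0 <= (1 - l) * t by rewrite mulr_ge0.
have -> : l *: (s *: p + (1 - s) *: x) + (1 - l) *: (t *: p + (1 - t) *: y) =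
  (1 - m) *: p + ((l * (1 - s)) *: x + ((1 - l) * (1 - t)) *: y).
  rewrite !scalerDr !scalerA addrACA -scalerDl; congr (_ *: _ + _).
  by rewrite /m; ring.
exists (1 - m); first by rewrite /= in_itv/= /m; apply/andP; split; lra.
have [m0|m0] := eqVneq m 0.
  exists x => //; rewrite subKr m0 scale0r.
  have -> : l * (1 - s) = 0 by move: m0; rewrite /m; lra.
  have -> : (1 - l) * (1 - t) = 0 by move: m0; rewrite /m; lra.
  by rewrite !scale0r !addr0.
have mp : 0 < m by rewrite lt0r m0/= addr_ge0.
exists ((l * (1 - s) / m) *: x + (1 - l * (1 - s) / m) *: y).
  apply: cA => //; apply/andP; split; first by rewrite divr_ge0// ltW.
  by rewrite ler_pdivrMr// mul1r /m; lra.
rewrite subKr scalerDr !scalerA; congr (_ + (_ *: _ + _ *: _)).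
  by rewrite mulrC divfK.
by rewrite mulrBr mulr1 mulrCA divff// mulr1 /m addrAC subrr add0r.
Qed.

(** The convex hull of [s], built as iterated cones so that compactness follows
    from that of a product. *)
Lemma compact_convex_between (A : set X) (s : seq X) :
  convex_set (A : set (convex_lmodType X)) -> (forall x, x \in s -> A x) ->
  exists C : set X, [/\ compact C, convex_set (C : set (convex_lmodType X)),
    forall x, x \in s -> C x & C `<=` A].
Proof.
move=> cA; elim: s => [_|p s IHs sA].
  exists set0; split=> [|x y l|x|x]; rewrite ?inE//; exact: compact0.
have [x xs|C [cC convC sC CA]] := IHs; first by apply: sA; rewrite inE xs orbT.
have Ap : A p by apply: sA; rewrite mem_head.
have [->|s0] := eqVneq s [::].
  exists [set p]; split=> [|x y l|x|_ ->//]; first exact: compact_set1.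
    by rewrite !inE => -> ->; rewrite convmm.
  by rewrite inE => /eqP.
have [y ys] : exists y, y \in s.
  by case: (s) s0 => // y s' _; exists y; rewrite mem_head.
exists (cone_over p C); split.
- exact: compact_cone_over.
- exact: convex_cone_over.
- move=> x; rewrite inE => /predU1P[->|xs].
    exists 1; first by rewrite /= in_itv/= ler01 lexx.
    by exists y; [exact: sC|rewrite subrr scale0r addr0 scale1r].
  exists 0; first by rewrite /= in_itv/= ler01 lexx.
  by exists x; [exact: sC|rewrite subr0 scale0r add0r scale1r].
- move=> _ [t /= t01 [z Cz <-]]; move/convex_setP : cA; apply => //.
  exact: CA.
Qed.

Lemma exists_min_norm A : compact A -> A !=set0 ->
  exists z, A z /\ forall w, A w -> `|z| <= `|w|.
Proof.
move=> cA A0.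
have [|z zA zmin] := @compact_EVT_min X R (fun x => `|x|) A A0 cA.
  by apply: continuous_subspaceT; exact: norm_continuous.
by exists z; split=> [|w Aw]; [exact: set_mem|exact/zmin/mem_set].
Qed.

End Hull.

(** * Resampling one coordinate of a rainbow tuple *)

Section Resampling.
Context {k : nat} {I : 'I_k -> finType}.
Local Notation T := {dffun forall i : 'I_k, I i}.
Implicit Types (c : T) (j i : 'I_k).

Definition update c j (a : I j) : T := [ffun i => eqtype.dfwith c a i].
Arguments update c j a : clear implicits.

Lemma update_in c j (a : I j) : update c j a j = a.
Proof. by rewrite ffunE dfwith_in. Qed.

Lemma update_out c j (a : I j) i : j != i -> update c j a i = c i.
Proof. by move=> ji; rewrite ffunE dfwith_out. Qed.

Lemma update_updateK c j (a : I j) : update (update c j a) j (c j) = c.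
Proof.
apply/ffunP => i; have [<-|ji] := eqVneq j i; first by rewrite update_in.
by rewrite !update_out.
Qed.

(** Both sides count pairs of a tuple [c] of [A] and an element [a] of [I j]:
    on the left those with [a] in [P c], on the right those with [c j] in
    [P c].  Exchanging [a] with the coordinate [c j] is an involution between
    the two, since neither [A] nor [P] looks at that coordinate. *)
Lemma sum_card_resample j (A : {set T}) (P : T -> {set I j}) :
  (forall c a, (update c j a \in A) = (c \in A)) ->
  (forall c a, P (update c j a) = P c) ->
  (\sum_(c in A) #|P c| = #|[set c in A | c j \in P c]%SET| * #|I j|)%N.
Proof.
move=> AU PU; pose swap (ca : T * I j) := (update ca.1 j ca.2, ca.1 j).
have swapK : involutive swap.
  by move=> [c a]; rewrite /swap/= update_updateK update_in.
under eq_bigr do rewrite -sum1_card.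
rewrite pair_big_dep/= (reindex_inj (inv_inj swapK))/=.
under eq_bigl do rewrite AU PU.
rewrite sum1dep_card -cardsT -cardsX; apply: eq_card => -[c a].
by rewrite !inE/= andbT.
Qed.

Lemma lt_card_resample (R : realType) (g : R) j (A : {set T})
    (P : T -> {set I j}) :
  (forall c a, (update c j a \in A) = (c \in A)) ->
  (forall c a, P (update c j a) = P c) ->
  (forall c, g * #|I j|%:R < #|P c|%:R) -> (0 < #|A|)%N ->
  g * #|A|%:R < #|[set c in A | c j \in P c]%SET|%:R.
Proof.
move=> AU PU gP A0; have [c0 Ac0] := card_gt0P A0.
have Ij0 : (0 < #|I j|)%N by apply/card_gt0P; exists (c0 j).
rewrite -(@ltr_pM2r _ #|I j|%:R) ?ltr0n// -natrM -sum_card_resample// natr_sum.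
rewrite mulrAC [ltLHS]mulr_natr -sumr_const.
apply: ltr_sum => [|c _]; last exact: gP.
by apply/hasP; exists c0; rewrite ?mem_index_enum.
Qed.

End Resampling.

(** * Tuples evading their nearest points *)

Lemma scaled_ballP (R : realType) (X : normedModType R) (r : R) (x z : X) :
  0 < r -> scaled_ball r x z <-> `|z - x| <= r.
Proof.
move=> r0; split=> [[b /= b1 <-]|zr].
  by rewrite addrK normrZ gtr0_norm// ler_piMr// ltW.
exists (r^-1 *: (z - x)).
  by rewrite /unit_ball/= normrZ gtr0_norm ?invr_gt0// ler_pdivrMl// mulr1.
by rewrite scalerKV ?gt_eqF//= ?subrK// lt0r_neq0.
Qed.

Arguments update {k I} c j a.
Arguments rseq {R} X j : simpl never.

Section Greedy.
Context {R : realType} {X : normedModType R} (dimX : dim_ge2 X).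
Context {k : nat} {I : 'I_k -> finType} (K : forall i : 'I_k, I i -> set X).
Arguments K : clear implicits.
Local Notation T := {dffun forall i : 'I_k, I i}.
Implicit Types (c : T) (j i : 'I_k).

Definition partial_inter c (m : nat) : set X :=
  \bigcap_(i in [set i : 'I_k | (i < m)%N]) K i (c i).

(** The point q_m of minimal norm in the intersection of the first [m] sets; it
    is meaningful only where that minimum is attained. *)
Definition nearest c (m : nat) : X :=
  get [set z | partial_inter c m z /\
               forall w, partial_inter c m w -> `|z| <= `|w|].

Definition missing (i : 'I_k) (r : R) (x : X) : {set I i} :=
  [set a | ~~ `[< K i a `&` scaled_ball r x !=set0 >]]%SET.

(** Tuples whose first [m] sets are greedy choices: the set in position [i]
    misses the ball around the nearest point of the intersection of the sets in
    positions before [i]. *)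
Definition evading (r : R) (m : nat) : {set T} :=
  [set c : T | [forall i : 'I_k, (i < m)%N ==>
                (c i \in missing i r (nearest c i))]]%SET.

Lemma evading0 r : evading r 0 = [set: T]%SET.
Proof. by apply/setP => c; rewrite !inE; apply/forallP. Qed.

Lemma evadingS r j : evading r j.+1 =
  [set c : T in evading r j | c j \in missing j r (nearest c j)]%SET.
Proof.
apply/setP => c; rewrite [LHS]inE [RHS]inE [X in X && _]inE.
apply/forallP/andP => [ev|[/forallP ev evj] i].
  split; last by have := ev j; rewrite ltnSn.
  apply/forallP => i; apply/implyP => ij.
  by have := ev i; rewrite ltnS (ltnW ij).
apply/implyP; rewrite ltnS leq_eqVlt => /predU1P[/val_inj ->//|ij].
by have := ev i; rewrite ij.
Qed.

Lemma partial_inter_update c j a (m : nat) : (m <= j)%N ->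
  partial_inter (update c j a) m = partial_inter c m.
Proof.
move=> mj; apply: eq_bigcapr => i /= im; rewrite update_out//.
by rewrite -val_eqE/= neq_ltn (leq_trans im mj) orbT.
Qed.

Lemma nearest_update c j a (m : nat) : (m <= j)%N ->
  nearest (update c j a) m = nearest c m.
Proof. by move=> mj; rewrite /nearest partial_inter_update. Qed.

Lemma evading_update r c j a :
  (update c j a \in evading r j) = (c \in evading r j).
Proof.
rewrite !inE; apply: eq_forallb => i; case: ltnP => //= ij.
rewrite update_out ?nearest_update ?(ltnW ij)//.
by rewrite -val_eqE/= neq_ltn ij orbT.
Qed.

(** Each position keeps more than a fraction [g] of the tuples, because the
    condition on coordinate [j] involves, besides [c j], only coordinates before
    [j]. *)
Lemma evading_card (r g : R) : 0 <= g -> (forall i : 'I_k, (0 < #|I i|)%N) ->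
  (forall i x, g * #|I i|%:R < #|missing i r x|%:R) ->
  forall m, (m < k)%N -> g ^+ m.+1 * #|T|%:R < #|evading r m.+1|%:R.
Proof.
move=> g0 I0 gmiss.
have step (j : 'I_k) : (0 < #|evading r j|)%N ->
    g * #|evading r j|%:R < #|evading r j.+1|%:R.
  move=> ev0; rewrite evadingS; apply: lt_card_resample => // c a.
    exact: evading_update.
  by rewrite nearest_update.
elim=> [|m IHm] mk.
  have := step (Ordinal mk); rewrite evading0 cardsT expr1; apply.
  by rewrite card_dep_ffun foldrE big_map big_enum/= prodn_gt0.
have {}IHm := IHm (ltnW mk).
have gT0 : 0 <= g ^+ m.+1 * #|T|%:R by rewrite mulr_ge0// exprn_ge0.
apply: le_lt_trans (step (Ordinal mk) _).
  by rewrite exprS -mulrA ler_wpM2l// ltW.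
by rewrite -(ltr0n R); apply: le_lt_trans IHm.
Qed.

Lemma nearestP c m :
  (exists z, partial_inter c m z /\
     forall w, partial_inter c m w -> `|z| <= `|w|) ->
  partial_inter c m (nearest c m) /\
    forall w, partial_inter c m w -> `|nearest c m| <= `|w|.
Proof. exact: (@getPex _ [set z | _ /\ _]). Qed.

Context (K_compact : forall i a, compact (K i a)).
Context (K_convex :
  forall i a, convex_set (K i a : set (convex_lmodType X))).

Lemma nearest0 c : nearest c 0 = 0.
Proof.
have [|_ /(_ 0)] := @nearestP c 0.
  by exists 0; split=> [i|w _] //=; rewrite normr0.
by rewrite normr0 normr_le0 => nz; apply/eqP/nz.
Qed.

Lemma nearestS c j : partial_inter c j.+1 !=set0 ->
  partial_inter c j.+1 (nearest c j.+1) /\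
    forall w, partial_inter c j.+1 w -> `|nearest c j.+1| <= `|w|.
Proof.
move=> C0; apply: nearestP; apply: exists_min_norm => //.
apply: (@subclosed_compact _ _ (K j (c j))) => //; last first.
  by move=> z; apply => /=.
apply: closed_bigI => i _.
by apply: compact_closed => //; exact: norm_hausdorff.
Qed.

Lemma partial_inter_mono c (m m' : nat) : (m <= m')%N ->
  partial_inter c m' `<=` partial_inter c m.
Proof. by move=> mm' z Cz i /= im; apply: Cz => /=; exact: leq_trans mm'. Qed.

Lemma partial_inter_convex c m (x y : X) (t : R) : 0 <= t <= 1 ->
  partial_inter c m x -> partial_inter c m y ->
  partial_inter c m (t *: x + (1 - t) *: y).
Proof.
move=> t01 Cx Cy i im; have /convex_setP := @K_convex i (c i); apply => //.
- exact: Cx.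
- exact: Cy.
Qed.

Lemma missing_lt i (r : R) a x z : 0 < r -> a \in missing i r x -> K i a z ->
  r < `|z - x|.
Proof.
move=> r0; rewrite inE => /asboolPn miss Kz; rewrite ltNge; apply/negP => zr.
by apply: miss; exists z; split=> //; exact/scaled_ballP.
Qed.

(** Index [m.+1] is the number of sets intersected, so the first case is
    [|q_1| > r_k], as [rseq X 1 = 1].  In the inductive step the bound
    [|q_(m+1)| <= |q_(m+2)|] is what allows [zeta] to be taken at [r_(m+2)]:
    assuming [|q_(m+2)| <= r_k / r_(m+2)], the displacement, which exceeds
    [r_k], is at least [r_(m+2) * |q_(m+1)|]. *)
Lemma nearest_growth c (m : nat) : c \in evading (rseq X k) k ->
  partial_inter c k !=set0 -> (m < k)%N ->
  rseq X k / rseq X m.+1 < `|nearest c m.+1|.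
Proof.
move=> ev [p Cp]; elim: m => [|m IHm] mk.
  rewrite divr1.
  have r0 : 0 < rseq X k by rewrite -(prednK mk) rseq_gt0.
  have C1 : partial_inter c 1 !=set0 by exists p; exact: partial_inter_mono Cp.
  have [C1n _] := @nearestS c (Ordinal mk) C1.
  have := ev; rewrite inE => /forallP/(_ (Ordinal mk)); rewrite mk/=.
  move=> /(missing_lt r0)/(_ (C1n (Ordinal mk) (ltnSn _))).
  by rewrite nearest0 subr0.
have m1k := ltnW mk.
have k0 : (0 < k)%N by exact: leq_ltn_trans mk.
have r0 : 0 < rseq X k by rewrite -(prednK k0) rseq_gt0.
have C1 : partial_inter c m.+1 !=set0 by exists p; exact: partial_inter_mono Cp.
have C2 : partial_inter c m.+2 !=set0 by exists p; exact: partial_inter_mono Cp.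
have [Cx xmin] := @nearestS c (Ordinal m1k) C1.
have [Cw wmin] := @nearestS c (Ordinal mk) C2.
have {IHm} xlt := IHm m1k.
have := ev; rewrite inE => /forallP/(_ (Ordinal mk)); rewrite mk/=.
move=> /(missing_lt r0)/(_ (Cw (Ordinal mk) (ltnSn _))).
move: Cx xmin Cw wmin xlt => /=.
set x := nearest c m.+1; set w := nearest c m.+2 => Cx xmin Cw wmin xlt wx.
have rm0 := rseq_gt0 dimX m; have rm1 := rseq_gt0 dimX m.+1.
have nx : 0 < `|x| by apply: lt_trans xlt; rewrite divr_gt0.
rewrite ltNge; apply/negP => wle.
have Cw1 : partial_inter c m.+1 w by exact: partial_inter_mono Cw.
have xw := xmin w Cw1.
have : `|x| * zeta_minus X (rseq X m.+2) <= `|x + (w - x)|.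
  apply: norm_zeta_minus_le => //; first by rewrite -normr_gt0.
    apply: norm_min_ray => t t01; apply: xmin.
    have -> : x + t *: (w - x) = t *: w + (1 - t) *: x.
      by rewrite scalerBr scalerBl scale1r addrCA.
    exact: partial_inter_convex.
  apply/ltW/(le_lt_trans _ wx); rewrite mulrC -ler_pdivlMr//.
  exact: le_trans xw wle.
rewrite addrC subrK leNgt => /negP; apply.
apply: le_lt_trans wle _.
have := rseq_eq dimX m => rE.
have z0 : 0 < zeta_minus X (rseq X m.+2).
  exact: lt_le_trans (zeta_minus_ge1 dimX _).
rewrite -(ltr_pM2r z0) in xlt; apply: le_lt_trans xlt.
by rewrite -rE invfM mulrA divfK// gt_eqF.
Qed.

Lemma evading_disjoint c : (0 < k)%N -> c \in evading (rseq X k) k ->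
  ~ ((\bigcap_(i in [set: 'I_k]) K i (c i)) `&` unit_ball !=set0).
Proof.
move=> k0 ev [z [Kz z1]].
have Cz : partial_inter c k z by move=> i _; exact: Kz.
have [m km] : exists m, k = m.+1 by exists k.-1; rewrite prednK.
have mk : (m < k)%N by rewrite km.
have := nearest_growth ev (ex_intro _ z Cz) mk.
have C1 : partial_inter c m.+1 z by rewrite -km.
have [_ /(_ z C1) /= nz] := @nearestS c (Ordinal mk) (ex_intro _ z C1).
rewrite km divff ?gt_eqF ?rseq_gt0// ltNge => /negP; apply.
exact: le_trans nz z1.
Qed.

End Greedy.

(** * Fractional colourful Helly theorem *)

Theorem theorem4p6 (R : realType) (X : completeNormedModType R)
  (dimX : dim_ge2 X) (ucX : uniformly_convex X)
  (k : nat) (k_ge1 : (1 <= k)%N) (alpha : R) (alpha01 : 0 < alpha <= 1)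
  (I : 'I_k -> finType) (F : forall i : 'I_k, I i -> set X)
  (F_nonempty : forall i : 'I_k, (0 < #|I i|)%N)
  (F_convex : forall (i : 'I_k) (a : I i),
     convex_set (F i a : set (convex_lmodType X)))
  (F_rainbow :
     alpha * #|{: {dffun forall i : 'I_k, I i}}|%:R <=
     #|[set c : {dffun forall i : 'I_k, I i} |
         `[< (\bigcap_(i in [set: 'I_k]) F i (c i)) `&` unit_ball !=set0 >]]%SET|%:R) :
  let beta : R := 1 - (1 - alpha) `^ (k%:R^-1) in
  exists (x : X) (i : 'I_k),
    beta * #|I i|%:R <=
    #|[set a : I i | `[< F i a `&` scaled_ball (rseq X k) x !=set0 >]]%SET|%:R.
Proof.
move=> beta; apply: contrapT => none.
have few (i : 'I_k) (x : X) :
    #|[set a : I i | `[< F i a `&` scaled_ball (rseq X k) x !=set0 >]]%SET|%:R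
    < beta * #|I i|%:R.
  by rewrite ltNge; apply/negP => le; apply: none; exists x, i.
pose T := {dffun forall i : 'I_k, I i}.
set meet := (X in _ <= #|X|%:R) in F_rainbow.
(* One common point in the unit ball for each tuple that has one; each family
   member is then shrunk to a compact convex set that still contains the chosen
   points of the tuples through it. *)
have /choice[pt ptP] : forall c : T, exists p : X, c \in meet ->
    (forall i, F i (c i) p) /\ unit_ball p.
  move=> c; have [|] := boolP (c \in meet); last by exists 0.
  rewrite inE => /asboolP[p [Fp Bp]]; exists p => _; split=> // i.
  exact: Fp.
have core (i : 'I_k) (a : I i) : exists C : set X,
    [/\ compact C, convex_set (C : set (convex_lmodType X)),
      forall c : T, c \in meet -> c i = a -> C (pt c) & C `<=` F i a].
  pose s := [seq pt c | c <- enum [set c : T in meet | c i == a]%SET].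
  have [|C [cC convC sC CF]] :=
      @compact_convex_between R X (F i a) s (@F_convex i a).
    move=> x /mapP[c]; rewrite mem_enum inE => /andP[cm /eqP <-] ->.
    exact: (ptP c cm).1.
  exists C; split=> // c cm ca; apply: sC; apply/mapP; exists c => //.
  by rewrite mem_enum inE cm ca/=.
have {core} /choice[K0 K0P] : forall ia : {i : 'I_k & I i}, exists C : set X,
    [/\ compact C, convex_set (C : set (convex_lmodType X)),
      forall c : T, c \in meet -> c (tag ia) = tagged ia -> C (pt c) &
      C `<=` F (tag ia) (tagged ia)].
  by move=> [i a]; exact: core.
pose K i (a : I i) := K0 (Tagged I a).
have Kcompact i (a : I i) : compact (K i a) by have [] := K0P (Tagged I a).
have Kconvex i (a : I i) : convex_set (K i a : set (convex_lmodType X)).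
  by have [] := K0P (Tagged I a).
have Kpt i (c : T) : c \in meet -> K i (c i) (pt c).
  by move=> cm; have [_ _ /(_ c cm erefl)] := K0P (Tagged I (c i)).
have KF i (a : I i) : K i a `<=` F i a by have [] := K0P (Tagged I a).
pose g : R := (1 - alpha) `^ k%:R^-1.
have /andP[a0 a1] := alpha01.
have g0 : 0 <= g by exact: powR_ge0.
have gk : g ^+ k = 1 - alpha.
  rewrite -powR_mulrn// -powRrM mulVf ?powRr1 ?subr_ge0//.
  by rewrite pnatr_eq0 -lt0n.
have many (i : 'I_k) (x : X) :
    g * #|I i|%:R < #|missing K i (rseq X k) x|%:R.
  set Kmeet := [set a : I i |
    `[< K i a `&` scaled_ball (rseq X k) x !=set0 >]]%SET.
  have -> : missing K i (rseq X k) x = (~: Kmeet)%SET.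
    by apply/setP => a; rewrite !inE.
  have := cardsC Kmeet => /(congr1 (fun n => n%:R : R)); rewrite natrD.
  have : #|Kmeet|%:R < beta * #|I i|%:R.
    apply: le_lt_trans (few i x); rewrite ler_nat; apply: subset_leq_card.
    apply/fintype.subsetP => a; rewrite !inE => -[z [Kz Bz]].
    by exists z; split=> //; exact: (KF _ _ _ Kz).
  by rewrite /beta -/g; lra.
have := @evading_card R X k I K (rseq X k) g g0 F_nonempty many k.-1.
rewrite prednK// => /(_ (leqnn k)); rewrite gk => big.
have : (#|evading K (rseq X k) k| + #|meet| <= #|{: T}|)%N.
  rewrite -cardsUI [X in (_ + X)%N](_ : _ = 0%N) ?addn0 ?max_card//.
  apply/eqP; rewrite cards_eq0 -finset.subset0; apply/fintype.subsetP => c.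
  rewrite inE => /andP[/(evading_disjoint dimX Kcompact Kconvex k_ge1) dis cm].
  exfalso; apply: dis; exists (pt c).
  by split=> [i _|]; [exact: Kpt|exact: (ptP c cm).2].
by rewrite -(ler_nat R) natrD; move: big F_rainbow; rewrite /T; lra.
Qed.
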